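(* Let $(P,O)$ be a $\mathbb T$-labelled poset, $Q,R$ finite convex subposets of $P$, $\omega$ a $(Q,O)$-tableau and $\sigma$ an $(R,O)$-tableau. The cell transfer algorithm described in the context terminates after finitely many steps, and the resulting maps $\bar\omega$ and $\bar\sigma$ are a $(Q\wedge R,O)$-tableau and a $(Q\vee R,O)$-tableau respectively, which coincide with $(\omega\wedge\sigma)_{S^\diamond}$ and $(\omega\vee\sigma)_{S^\diamond}$.
   Context: Let $\mathbb P=\{1,2,\dots\}$; $s\lessdot t$ (or $t\gtrdot s$) means $t$ covers $s$. $\mathbb T$ is the set of weakly increasing functions $\mathbb P\to\mathbb Z\cup\{\infty\}$; a $\mathbb T$-labelling $O$ of $P$ assigns a function $O(s,t)=O(t,s)\in\mathbb T$ to each covering pair $\{s\lessdot t\}$. $Q\subseteq P$ is convex if $s,t\in Q$, $s\le r\le t$ imply $r\in Q$. For convex $Q$, a $(Q,O)$-tableau is a map $\tau:Q\to\mathbb P$ with $\tau(s)\le O(s,t)(\tau(t))$ for all covering pairs $s\lessdot t$ in $Q$. For convex $Q$ and $s\notin Q$: $s<Q$ if $s<t$ for some $t\in Q$; $s>Q$ if $s>t$ for some $t\in Q$; $s\sim Q$ if $s\in Q$ or $s$ is incomparable to all elements of $Q$. $Q\wedge R=\{s\in R: s<Q\}\cup\{s\in Q: s\sim R\text{ or } s<R\}$, $Q\vee R=\{s\in Q: s>R\}\cup\{s\in R: s\sim Q\text{ or } s>Q\}$. $(Q\cap R)^+=\{x\in Q\cap R:\omega(x)<\sigma(x)\}$,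 a graph with edges the covering pairs among its elements. $\mathrm{bd}(R)=\{x\in Q\cap R: x\gtrdot y\text{ for some } y\in R\setminus Q\}$, $\mathrm{bd}(Q)=\{x\in Q\cap R: x\lessdot y\text{ for some } y\in Q\setminus R\}$; $\mathrm{bd}(R)^+$ (resp. $\mathrm{bd}(Q)^+$) is the union of connected components of $(Q\cap R)^+$ meeting $\mathrm{bd}(R)$ (resp. $\mathrm{bd}(Q)$); $S^*=\mathrm{bd}(Q)^+\cup\mathrm{bd}(R)^+$. For $S\subseteq Q\cap R$: $(\omega\wedge\sigma)_S:Q\wedge R\to\mathbb P$ takes value $\sigma(x)$ if $x\in R\setminus Q$ or $x\in S$ and $\omega(x)$ otherwise; $(\omega\vee\sigma)_S:Q\vee R\to\mathbb P$ takes value $\omega(x)$ if $x\in Q\setminus R$ or $x\in S$ and $\sigma(x)$ otherwise. $S\subseteq S^*$ is transferrable if $(\omega\wedge\sigma)_S$ is a $(Q\wedge R,O)$-tableau and $(\omega\vee\sigma)_S$ is a $(Q\vee R,O)$-tableau; $S^\diamond$ is the smallest transferrable subset of $S^*$ (the intersection of all transferrable subsets, which is itself transferrable). The algorithm: (1) Set $\bar\omega:Q\wedge R\to\mathbb P$, $\bar\omega(s)=\omega(s)$ if $s\in Q$ and $\sigma(s)$ if $s\in R\setminus Q$; set $\bar\sigma:Q\vee R\to\mathbb P$, $\bar\sigma(s)=\sigma(s)$ if $s\in R$ and $\omega(s)$ if $s\in Q\setminus R$. (2) To transfer a cell $s\in Q\cap R$ means to swap the values $\bar\omega(s)$ and $\bar\sigma(s)$.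 A cell $s\in Q\cap R$ not transferred in a previous iteration is critical if one of: (a) some $t\in R$ with $s\gtrdot t$ has $O(s,t)(\bar\omega(s))<\bar\omega(t)$; (b) some $t\in Q\cap R$ with $t\gtrdot s$ has $O(s,t)(\bar\sigma(t))<\bar\sigma(s)$; (c) some $t\in Q$ with $t\gtrdot s$ has $O(s,t)(\bar\sigma(t))<\bar\sigma(s)$; (d) some $t\in Q\cap R$ with $s\gtrdot t$ has $O(s,t)(\bar\omega(s))<\bar\omega(t)$. Transfer all critical cells simultaneously. (3) Repeat step (2) until no critical cells exist. *)

(* Defs.v *)
From mathcomp Require Import all_boot all_order all_algebra.
From mathcomp Require Import finmap.
From mathcomp Require Import boolp constructive_ereal.

Set Implicit Arguments.
Unset Strict Implicit.
Unset Printing Implicit Defensive.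

Import Order.TTheory.

Local Open Scope order_scope.
Local Open Scope fset_scope.

Definition posint : Type := {n : nat | (0 < n)%N}.

Definition ext_of_posint (m : posint) : \bar int := ((val m)%:Z)%:E.

(* Z with an added top element is the part of [\bar int] that avoids -oo. *)
Record Tfun := MkTfun {
  Tfun_val :> posint -> \bar int;
  Tfun_nNy : forall m : posint, Tfun_val m != -oo%E;
  Tfun_mono : forall m n : posint,
    (val m <= val n)%N -> (Tfun_val m <= Tfun_val n)%E
}.

Section CellTransfer.
Context {d : Order.disp_t} {P : porderType d}.
Implicit Types (s t r x y : P) (Q R S : {fset P}).

Definition covers s t : Prop := s < t /\ (forall r, ~ (s < r < t)).

End CellTransfer.

Notation "s ⋖ t" := (covers s t) (at level 70, no associativity).
Notation "s ⋗ t" := (covers t s) (at level 70, no associativity, only parsing).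

(* A labelling is a total function of two arguments, but only its values on
   covering pairs are constrained here or used below. *)
Record Tlabelling (d : Order.disp_t) (P : porderType d) := MkTlabelling {
  label :> P -> P -> Tfun;
  label_sym : forall s t : P, s ⋖ t -> label s t = label t s
}.

Section Tableaux.
Context {d : Order.disp_t} {P : porderType d}.
Implicit Types (s t r x y : P) (Q R S : {fset P}).

Definition convex Q : Prop :=
  forall s t r, s \in Q -> t \in Q -> s <= r <= t -> r \in Q.

(* Maps out of a finite subset Q of P are represented by total functions on P,
   of which only the values on Q are meaningful. *)
Definition is_tableau (O : Tlabelling P) Q (tau : P -> posint) : Prop :=
  forall s t, s \in Q -> t \in Q -> s ⋖ t ->
    (ext_of_posint (tau s) <= O s t (tau t))%E.

Definition lt_fset s Q : bool := (s \notin Q) && has (fun t => s < t) Q.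
Definition gt_fset s Q : bool := (s \notin Q) && has (fun t => t < s) Q.
Definition sim_fset s Q : bool := (s \in Q) || all (fun t => s >< t) Q.

Definition wedge Q R : {fset P} :=
  [fset s in R | lt_fset s Q] `|` [fset s in Q | sim_fset s R || lt_fset s R].
Definition vee Q R : {fset P} :=
  [fset s in Q | gt_fset s R] `|` [fset s in R | sim_fset s Q || gt_fset s Q].

Section Pair.
Variables (O : Tlabelling P) (Q R : {fset P}) (omega sigma : P -> posint).

Definition plus_part : {fset P} :=
  [fset x in Q `&` R | (val (omega x) < val (sigma x))%N].

Definition adjacent : rel plus_part :=
  fun u v => `[< val u ⋖ val v \/ val v ⋖ val u >].

Definition bdR : {fset P} :=
  [fset x in Q `&` R | `[< exists2 y, y \in R `\` Q & x ⋗ y >]].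
Definition bdQ : {fset P} :=
  [fset x in Q `&` R | `[< exists2 y, y \in Q `\` R & x ⋖ y >]].

(* The union of the connected components of the graph [plus_part] that
   meet B. *)
Definition components_meeting (B : {fset P}) : {fset P} :=
  [fset x in plus_part |
    [exists u : plus_part, (val u == x) &&
      [exists v : plus_part, (val v \in B) && connect adjacent u v]]].

Definition Sstar : {fset P} :=
  components_meeting bdQ `|` components_meeting bdR.

Definition wedge_map (S : {fset P}) : P -> posint :=
  fun x => if (x \in R `\` Q) || (x \in S) then sigma x else omega x.
Definition vee_map (S : {fset P}) : P -> posint :=
  fun x => if (x \in Q `\` R) || (x \in S) then omega x else sigma x.

Definition transferrable (S : {fset P}) : Prop :=
  [/\ S `<=` Sstar,
      is_tableau O (wedge Q R) (wedge_map S)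
    & is_tableau O (vee Q R) (vee_map S)].

(* The intersection of all transferrable sets. *)
Definition Sdiamond : {fset P} :=
  [fset x in Sstar | `[< forall S : {fset P}, transferrable S -> x \in S >]].

Record state := MkState {
  obar : P -> posint;
  sbar : P -> posint;
  transferred : {fset P}
}.

Definition init : state := {|
  obar := fun s => if s \in Q then omega s else sigma s;
  sbar := fun s => if s \in R then sigma s else omega s;
  transferred := fset0
|}.

Definition critical (st : state) s : Prop :=
  [/\ s \in Q `&` R, s \notin transferred st &
   [\/ exists t, [/\ t \in R, s ⋗ t &
         (O s t (obar st s) < ext_of_posint (obar st t))%E],
       exists t, [/\ t \in Q `&` R, t ⋗ s &
         (O s t (sbar st t) < ext_of_posint (sbar st s))%E],
       exists t, [/\ t \in Q, t ⋗ s &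
         (O s t (sbar st t) < ext_of_posint (sbar st s))%E] |
       exists t, [/\ t \in Q `&` R, s ⋗ t &
         (O s t (obar st s) < ext_of_posint (obar st t))%E]]].

Definition critical_cells (st : state) : {fset P} :=
  [fset s in Q `&` R | `[< critical st s >]].

Definition step (st : state) : state :=
  let C := critical_cells st in {|
    obar := fun s => if s \in C then sbar st s else obar st s;
    sbar := fun s => if s \in C then obar st s else sbar st s;
    transferred := transferred st `|` C
  |}.

Definition run (n : nat) : state := iter n step init.

Definition halted (st : state) : Prop := forall s, ~ critical st s.

End Pair.
End Tableaux.

(* Main.v *)
(** At every stage the algorithm is described by the set T of transferred
    cells: [obar] and [sbar] are the maps (omega /\ sigma)_T and
    (omega \/ sigma)_T.  A critical cell s witnesses a covering pair between s
    and some t that is either transferred or outside Q /\ R, along which any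
    set containing T but not s violates a tableau inequality.  Monotonicity of
    the labels gives omega s < sigma s, so T grows inside S* and inside every
    transferrable set.  Conversely, convexity of Q and R confines the possible
    violations in the wedge and the vee to critical cells, so when the
    algorithm halts T is itself transferrable, hence the smallest such set. *)
Require Import Defs.
From mathcomp Require Import all_boot all_order all_algebra.
From mathcomp Require Import finmap.
From mathcomp Require Import boolp constructive_ereal.

Set Implicit Arguments.
Unset Strict Implicit.
Unset Printing Implicit Defensive.

Import Order.TTheory.

Local Open Scope order_scope.
Local Open Scope fset_scope.

(** * Comparing values of labels *)

Lemma ext_of_posint_le (m n : posint) :
  (ext_of_posint m <= ext_of_posint n)%E = (val m <= val n)%N.
Proof. by rewrite /ext_of_posint lee_fin. Qed.

Lemma Tfun_lt_inv (f : Tfun) (m n : posint) :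
  (f m < f n)%E -> (val m < val n)%N.
Proof.
move=> fmn; rewrite ltnNge; apply/negP => /(Tfun_mono f) fnm.
by move: fmn; rewrite ltNge fnm.
Qed.

Section CellTransfer.
Context {d : Order.disp_t} {P : porderType d}.
Variables (O : Tlabelling P) (Q R : {fset P}) (omega sigma : P -> posint).
Implicit Types (s t x y : P) (S T B : {fset P}) (st : @state d P).

Local Notation plus := (plus_part Q R omega sigma).
Local Notation Sst := (Sstar Q R omega sigma).

(** * The graph on [plus_part] and the closure properties of S* *)

Lemma in_plus x :
  (x \in plus) = [&& x \in Q, x \in R & (val (omega x) < val (sigma x))%N].
Proof. by rewrite !inE /= andbA. Qed.

Lemma components_meetingP B x : reflect
  (exists u v : plus, [/\ val u = x, val v \in B &
     connect (@adjacent _ _ Q R omega sigma) u v])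
  (x \in components_meeting Q R omega sigma B).
Proof.
apply: (iffP idP).
  rewrite !inE /= => /andP[_ /existsP[u /andP[/eqP ux /existsP[v /andP[vB uv]]]]].
  by exists u, v.
case=> u [v [<- vB uv]]; rewrite inE /= inE (valP u) /=.
apply/existsP; exists u; rewrite eqxx /=.
by apply/existsP; exists v; rewrite vB.
Qed.

Lemma components_meeting_base B x :
  x \in plus -> x \in B -> x \in components_meeting Q R omega sigma B.
Proof.
move=> xp xB; apply/components_meetingP.
by exists [` xp], [` xp]; split => //; apply: connect0.
Qed.

Lemma components_meeting_adj B x y : x \in plus -> x ⋖ y \/ y ⋖ x ->
  y \in components_meeting Q R omega sigma B ->
  x \in components_meeting Q R omega sigma B.
Proof.
move=> xp xy /components_meetingP[u [v [uy vB uv]]].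
apply/components_meetingP; exists [` xp], v; split => //.
apply: connect_trans uv; apply: connect1.
by apply/asboolP; rewrite /= uy.
Qed.

(** S* is a union of connected components of [plus_part], so it absorbs every neighbour that lies in
    [plus_part]. *)
Lemma Sstar_adj x y : x \in plus -> x ⋖ y \/ y ⋖ x -> y \in Sst -> x \in Sst.
Proof.
move=> xp xy; rewrite !in_fsetU => /orP[] yB; apply/orP; [left|right];
  exact: components_meeting_adj yB.
Qed.

Lemma Sstar_bdR x y : x \in plus -> y \in R -> y \notin Q -> y ⋖ x -> x \in Sst.
Proof.
move=> xp yR yQ yx; rewrite in_fsetU; apply/orP; right.
apply: components_meeting_base => //; move: xp; rewrite in_plus => /and3P[xQ xR _].
rewrite !inE /= xQ xR /=; apply/asboolP; exists y => //.
by rewrite inE yQ yR.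
Qed.

Lemma Sstar_bdQ x y : x \in plus -> y \in Q -> y \notin R -> x ⋖ y -> x \in Sst.
Proof.
move=> xp yQ yR xy; rewrite in_fsetU; apply/orP; left.
apply: components_meeting_base => //; move: xp; rewrite in_plus => /and3P[xQ xR _].
rewrite !inE /= xQ xR /=; apply/asboolP; exists y => //.
by rewrite inE yQ yR.
Qed.

(** * Order geometry of the wedge and the vee, and the maps on them *)

Lemma in_wedge x : (x \in wedge Q R) =
  (x \in R) && lt_fset x Q || (x \in Q) && (sim_fset x R || lt_fset x R).
Proof. by rewrite !inE. Qed.

Lemma in_vee x : (x \in vee Q R) =
  (x \in Q) && gt_fset x R || (x \in R) && (sim_fset x Q || gt_fset x Q).
Proof. by rewrite !inE. Qed.

Lemma wedge_sub x : x \in wedge Q R -> (x \in Q) || (x \in R).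
Proof. by rewrite in_wedge => /orP[]/andP[-> _]; rewrite ?orbT. Qed.

Lemma vee_sub x : x \in vee Q R -> (x \in Q) || (x \in R).
Proof. by rewrite in_vee => /orP[]/andP[-> _]; rewrite ?orbT. Qed.

Lemma setI_wedge x : x \in Q -> x \in R -> x \in wedge Q R.
Proof. by move=> xQ xR; rewrite in_wedge xQ /sim_fset xR orbT. Qed.

Lemma setI_vee x : x \in Q -> x \in R -> x \in vee Q R.
Proof. by move=> xQ xR; rewrite in_vee xR /sim_fset xQ orbT. Qed.

Lemma below_wedge x y : x \in R -> y \in Q -> y \in R -> x < y -> x \in wedge Q R.
Proof.
move=> xR yQ yR xy; have [xQ|xQ] := boolP (x \in Q); first exact: setI_wedge.
by rewrite in_wedge xR /lt_fset xQ /=; apply/orP; left; apply/hasP; exists y.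
Qed.

Lemma above_vee x y : x \in Q -> y \in Q -> y \in R -> y < x -> x \in vee Q R.
Proof.
move=> xQ yQ yR yx; have [xR|xR] := boolP (x \in R); first exact: setI_vee.
by rewrite in_vee xQ /gt_fset xR /=; apply/orP; left; apply/hasP; exists y.
Qed.

(** Here y lies below some q in Q, so an x in Q with x < y < q would force y into Q by convexity. *)
Lemma wedge_lt_notinQ x y : convex Q ->
  y \in wedge Q R -> y \notin Q -> x < y -> x \notin Q.
Proof.
move=> cQ yw yQ xy; apply/negP => xQ; move: yw.
rewrite in_wedge (negbTE yQ) orbF => /andP[_ /andP[_ /hasP[q qQ yq]]].
by move/negP: yQ; apply; apply: (cQ x q) => //; rewrite !ltW.
Qed.

(** Here y is incomparable to all of R, which excludes x in R at once, or lies below some r in R,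
    and then convexity excludes it. *)
Lemma wedge_lt_notinR x y : convex R ->
  y \in wedge Q R -> y \notin R -> x < y -> x \notin R.
Proof.
move=> cR yw yR xy; apply/negP => xR; move: yw.
rewrite in_wedge (negbTE yR) /= /sim_fset (negbTE yR) /=.
case/andP=> _ /orP[/allP/(_ x xR)|/andP[_ /hasP[r rR yr]]].
  by rewrite comparable_sym /Order.comparable (ltW xy).
by move/negP: yR; apply; apply: (cR x r) => //; rewrite !ltW.
Qed.

(** This lemma and the next are the order duals of the preceding two, with Q and R exchanged. *)
Lemma vee_gt_notinR x y : convex R ->
  y \in vee Q R -> y \notin R -> y < x -> x \notin R.
Proof.
move=> cR yw yR yx; apply/negP => xR; move: yw.
rewrite in_vee (negbTE yR) orbF => /andP[_ /andP[_ /hasP[r rR ry]]].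
by move/negP: yR; apply; apply: (cR r x) => //; rewrite !ltW.
Qed.

Lemma vee_gt_notinQ x y : convex Q ->
  y \in vee Q R -> y \notin Q -> y < x -> x \notin Q.
Proof.
move=> cQ yw yQ yx; apply/negP => xQ; move: yw.
rewrite in_vee (negbTE yQ) /= /sim_fset (negbTE yQ) /=.
case/andP=> _ /orP[/allP/(_ x xQ)|/andP[_ /hasP[q qQ qy]]].
  by rewrite /Order.comparable (ltW yx).
by move/negP: yQ; apply; apply: (cQ q x) => //; rewrite !ltW.
Qed.

(* Off Q the value is [sigma] even outside R, as in [init]. *)
Definition obar_of T x := if (x \in Q) && (x \notin T) then omega x else sigma x.
Definition sbar_of T x := if (x \in R) && (x \notin T) then sigma x else omega x.

Lemma obar_of_wedge_map T :
  {in wedge Q R, obar_of T =1 wedge_map Q R omega sigma T}.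
Proof.
move=> x /wedge_sub; rewrite /obar_of /wedge_map inE.
by case: (x \in Q); case: (x \in R); case: (x \in T).
Qed.

Lemma sbar_of_vee_map T :
  {in vee Q R, sbar_of T =1 vee_map Q R omega sigma T}.
Proof.
move=> x /vee_sub; rewrite /sbar_of /vee_map inE.
by case: (x \in Q); case: (x \in R); case: (x \in T).
Qed.

Lemma eq_is_tableau (A : {fset P}) (f g : P -> posint) :
  {in A, f =1 g} -> is_tableau O A f -> is_tableau O A g.
Proof. by move=> fg tf s t sA tA st; rewrite -!fg //; apply: tf. Qed.

(** * The invariant and the meaning of criticality *)

Definition consistent st :=
  [/\ transferred st `<=` plus, obar st =1 obar_of (transferred st)
    & sbar st =1 sbar_of (transferred st)].

(** The four criticality tests, freed from the state: t carries sigma in the wedge, or omega in the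
    vee, for T and for every set containing T. *)
Definition violates T s :=
  (exists t, [/\ t \in R, t ⋖ s, (t \notin Q) || (t \in T)
       & (O t s (omega s) < ext_of_posint (sigma t))%E]) \/
  (exists t, [/\ t \in Q, s ⋖ t, (t \notin R) || (t \in T)
       & (O s t (omega t) < ext_of_posint (sigma s))%E]).

Hypotheses (tabQ : is_tableau O Q omega) (tabR : is_tableau O R sigma).

(** If t still carried its initial value from the same tableau as s, that tableau would rule out the
    strict inequality; so t is transferred or outside Q /\ R. *)
Lemma critical_violates st s : consistent st -> critical O Q R st s ->
  [/\ s \in Q, s \in R, s \notin transferred st & violates (transferred st) s].
Proof.
move=> [_ eo es] [sQR sT crit].
have [sQ sR] : s \in Q /\ s \in R by apply/andP; rewrite -in_fsetI.
(* [low] serves tests (a) and (d), [high] tests (b) and (c). *)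
have low t : t \in R -> t ⋖ s ->
    (O s t (obar st s) < ext_of_posint (obar st t))%E ->
    violates (transferred st) s.
  move=> tR ts; rewrite !eo /obar_of sQ sT -(label_sym O ts) /=.
  case: ifP => [/andP[tQ _]|tT lt]; first by rewrite ltNge tabQ.
  by left; exists t; split=> //; rewrite -[_ \in transferred st]negbK -negb_and tT.
have high t : t \in Q -> s ⋖ t ->
    (O s t (sbar st t) < ext_of_posint (sbar st s))%E ->
    violates (transferred st) s.
  move=> tQ ts; rewrite !es /sbar_of sR sT /=.
  case: ifP => [/andP[tR _]|tT lt]; first by rewrite ltNge tabR.
  by right; exists t; split=> //; rewrite -[_ \in transferred st]negbK -negb_and tT.
split=> //; case: crit => -[t []].
- exact: low.
- by rewrite in_fsetI => /andP[tQ _]; apply: high.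
- exact: high.
- by rewrite in_fsetI => /andP[_ tR]; apply: low.
Qed.

(** For t below s, the label sends omega s strictly under sigma t, hence under its value at sigma s,
    and monotonicity applies. For t above s, omega s <= O s t (omega t) < sigma s. *)
Lemma violates_plus T s : T `<=` plus -> s \in Q -> s \in R ->
  violates T s -> s \in plus.
Proof.
move=> /fsubsetP Tp sQ sR; rewrite in_plus sQ sR /= => -[] [t [tA ts _ lt]].
  exact: (Tfun_lt_inv (lt_le_trans lt (tabR tA sR ts))).
by have := le_lt_trans (tabQ sQ tA ts) lt; rewrite ltNge ext_of_posint_le -ltnNge.
Qed.

(** A witness outside Q /\ R makes s a boundary cell; a transferred witness is a neighbour of s
    already in S*. *)
Lemma violates_Sstar T s : T `<=` plus -> T `<=` Sst -> s \in Q -> s \in R ->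
  violates T s -> s \in Sst.
Proof.
move=> Tp /fsubsetP TS sQ sR vs; have sp := violates_plus Tp sQ sR vs.
case: vs => -[t [tA ts /orP[tN|/TS tS] _]].
- exact: Sstar_bdR ts.
- by apply: Sstar_adj tS => //; right.
- exact: Sstar_bdQ ts.
- by apply: Sstar_adj tS => //; left.
Qed.

(** If s were not in S, the maps of S would take on the pair exactly the values in the violated
    inequality, since t keeps its role when T grows to S. *)
Lemma violates_transferrable T S s : transferrable O Q R omega sigma S ->
  T `<=` S -> s \in Q -> s \in R -> violates T s -> s \in S.
Proof.
move=> [_ tw tv] /fsubsetP TS sQ sR vs; apply: contraT => sS.
case: vs => -[t [tA ts tT lt]].
- have := tw _ _ (below_wedge tA sQ sR ts.1) (setI_wedge sQ sR) ts.
  rewrite /wedge_map !in_fsetD sQ (negbTE sS) /= leNgt.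
  suff -> : (t \notin Q) && (t \in R) || (t \in S) by rewrite lt.
  by rewrite tA andbT; case/orP: tT => [->|/TS->] //; rewrite orbT.
- have := tv _ _ (setI_vee sQ sR) (above_vee tA sQ sR ts.1) ts.
  rewrite /vee_map !in_fsetD sR (negbTE sS) /= leNgt.
  suff -> : (t \notin R) && (t \in Q) || (t \in S) by rewrite lt.
  by rewrite tA andbT; case/orP: tT => [->|/TS->] //; rewrite orbT.
Qed.

(** * Running the algorithm: invariance and termination *)

Lemma critical_cellsP st s :
  reflect (critical O Q R st s) (s \in critical_cells O Q R st).
Proof.
rewrite /critical_cells in_fset inE /=; apply: (iffP andP) => [[_ /asboolP]//|cs].
by split; [case: cs | apply/asboolP].
Qed.

Lemma consistent_init : consistent (init Q R omega sigma).
Proof.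
by split; [exact: fsub0set | |] => x; rewrite /obar_of /sbar_of in_fset0 andbT.
Qed.

Lemma consistent_step st : consistent st -> consistent (step O Q R st).
Proof.
move=> cs; have [Tp eo es] := cs; split => [|x|x] /=.
- rewrite fsubUset Tp; apply/fsubsetP => s /critical_cellsP.
  by move=> /(critical_violates cs)[sQ sR _]; apply: violates_plus.
- rewrite eo es /obar_of /sbar_of in_fsetU.
  (* A critical cell is in Q /\ R and not yet transferred, so the swap turns omega into sigma here,
     and sigma into omega for [sbar]. *)
  case: critical_cellsP => [/(critical_violates cs)[-> -> -> _]|_].
    by rewrite orbT.
  by rewrite orbF.
- rewrite eo es /obar_of /sbar_of in_fsetU.
  case: critical_cellsP => [/(critical_violates cs)[-> -> -> _]|_].
    by rewrite orbT.
  by rewrite orbF.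
Qed.

Local Notation run := (run O Q R omega sigma).

Lemma consistent_run n : consistent (run n).
Proof.
elim: n => [|n IHn]; first exact: consistent_init.
exact: consistent_step.
Qed.

(** Used with S* and with each transferrable set, to bound the transferred cells from above. *)
Lemma run_transferred_ind (S : {fset P}) :
  (forall T s, T `<=` plus -> T `<=` S -> s \in Q -> s \in R -> violates T s ->
     s \in S) ->
  forall n, transferred (run n) `<=` S.
Proof.
move=> clS; elim=> [|n IHn]; first exact: fsub0set.
rewrite /= fsubUset IHn; apply/fsubsetP => s /critical_cellsP.
have cs := consistent_run n; have [Tp _ _] := cs.
by case/(critical_violates cs) => sQ sR _; apply: clS.
Qed.

(** Each step that does not start from a halted state enlarges the transferred set, which stays
    inside the finite set [plus_part]. *)
Lemma run_halts : exists n, halted O Q R (run n).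
Proof.
case: (pselect (exists n, halted O Q R (run n))) => // nhalt.
have grow n : (n <= #|` transferred (run n)|)%N.
  elim: n => // n IHn; apply: leq_ltn_trans IHn _.
  apply: fproper_ltn_card; rewrite fproperE fsubsetUl /=.
  (* If the step added nothing, a critical cell would already be transferred, which criticality
     forbids. *)
  apply/negP => /fsubsetP sub; apply: nhalt; exists n => s cs.
  have [_ _ + _] := critical_violates (consistent_run n) cs.
  by rewrite sub // in_fsetU; apply/orP; right; apply/critical_cellsP.
have [Tp _ _] := consistent_run #|` plus|.+1.
by have := leq_trans (grow _) (fsubset_leq_card Tp); rewrite ltnn.
Qed.

(** * The halted state: tableau conditions and minimality *)

Hypotheses (convQ : convex Q) (convR : convex R).

Lemma halted_wedge_tableau st : consistent st -> halted O Q R st ->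
  is_tableau O (wedge Q R) (obar st).
Proof.
move=> [/fsubsetP Tp eo es] halt s t sW tW st'.
have [tQ|tQ] := boolP (t \in Q); last first.
  have sQ := wedge_lt_notinQ convQ tW tQ st'.1.
  have := wedge_sub sW; have := wedge_sub tW.
  rewrite !eo /obar_of (negbTE sQ) (negbTE tQ) /= => tR sR.
  exact: tabR.
(* When s carries omega, the omega-tableau suffices: a transfer only raises the value at t, and the
   label is monotone. *)
have sameQ : obar st s = omega s -> s \in Q ->
    (ext_of_posint (obar st s) <= O s t (obar st t))%E.
  move=> -> sQ; rewrite eo /obar_of tQ /=; case: ifP => tT; first exact: tabQ.
  apply: le_trans (tabQ sQ tQ st') _; apply: Tfun_mono; apply: ltnW.
  by move/negbFE/Tp: tT; rewrite in_plus => /and3P[].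
have [sR|sR] := boolP (s \in R); last first.
  have sQ : s \in Q by have := wedge_sub sW; rewrite (negbTE sR) orbF.
  have sT : s \notin transferred st.
    by apply: contra sR => /Tp; rewrite in_plus => /and3P[].
  by apply: sameQ => //; rewrite eo /obar_of sQ sT.
have tR : t \in R by apply: contraT => /(wedge_lt_notinR convR tW)/(_ st'.1); rewrite sR.
have [tT|tT] := boolP (t \in transferred st); last first.
  (* An untransferred t in Q /\ R that broke the inequality would be critical by test (a), with
     witness s. *)
  rewrite leNgt; apply/negP => lt; apply: (halt t); split => //.
    by rewrite in_fsetI tQ.
  by apply: Or41; exists s; split=> //; rewrite -(label_sym O st').
have [/andP[sQ sT]|sN] := boolP ((s \in Q) && (s \notin transferred st)).
  by apply: sameQ => //; rewrite eo /obar_of sQ sT.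
by rewrite !eo /obar_of (negbTE sN) tT andbF; apply: tabR.
Qed.

(** Dual case analysis: when t carries sigma, the sigma-tableau suffices because a transfer only
    lowers the value at s; halting enters through test (c) at s. *)
Lemma halted_vee_tableau st : consistent st -> halted O Q R st ->
  is_tableau O (vee Q R) (sbar st).
Proof.
move=> [/fsubsetP Tp eo es] halt s t sV tV st'.
have [sR|sR] := boolP (s \in R); last first.
  have tR := vee_gt_notinR convR sV sR st'.1.
  have := vee_sub sV; have := vee_sub tV.
  rewrite !es /sbar_of (negbTE sR) (negbTE tR) /= !orbF => tQ sQ.
  exact: tabQ.
have sameR : sbar st t = sigma t -> t \in R ->
    (ext_of_posint (sbar st s) <= O s t (sbar st t))%E.
  move=> -> tR; rewrite es /sbar_of sR /=; case: ifP => sT; first exact: tabR.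
  apply: le_trans (tabR sR tR st'); rewrite ext_of_posint_le ltnW //.
  by move/negbFE/Tp: sT; rewrite in_plus => /and3P[].
have [tQ|tQ] := boolP (t \in Q); last first.
  have tR : t \in R by have := vee_sub tV; rewrite (negbTE tQ).
  have tT : t \notin transferred st.
    by apply: contra tQ => /Tp; rewrite in_plus => /and3P[].
  by apply: sameR => //; rewrite es /sbar_of tR tT.
have sQ : s \in Q by apply: contraT => /(vee_gt_notinQ convQ sV)/(_ st'.1); rewrite tQ.
have [sT|sT] := boolP (s \in transferred st); last first.
  rewrite leNgt; apply/negP => lt; apply: (halt s); split => //.
    by rewrite in_fsetI sQ.
  by apply: Or43; exists t.
have [/andP[tR tT]|tN] := boolP ((t \in R) && (t \notin transferred st)).
  by apply: sameR => //; rewrite es /sbar_of tR tT.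
by rewrite !es /sbar_of (negbTE tN) sT andbF; apply: tabQ.
Qed.

Lemma halted_Sdiamond n : halted O Q R (run n) ->
  transferred (run n) = Sdiamond O Q R omega sigma.
Proof.
move=> halt; have cs := consistent_run n; have [_ eo es] := cs.
have TS : transferred (run n) `<=` Sst.
  by apply: run_transferred_ind => T s; apply: violates_Sstar.
have Ttr : transferrable O Q R omega sigma (transferred (run n)).
  split=> //.
  - apply: eq_is_tableau (halted_wedge_tableau cs halt) => x xW.
    by rewrite eo obar_of_wedge_map.
  - apply: eq_is_tableau (halted_vee_tableau cs halt) => x xV.
    by rewrite es sbar_of_vee_map.
(* One inclusion holds because every transferrable set contains the transferred cells, the other
   because they form a transferrable set themselves. *)
apply/eqP; rewrite eqEfsubset; apply/andP; split; apply/fsubsetP => x.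
  move=> xT; rewrite !inE /=; apply/andP; split.
    by move/fsubsetP: TS => /(_ x xT); rewrite !inE.
  apply/asboolP => S Str; apply: (fsubsetP _ _ xT).
  by apply: run_transferred_ind => T s _; apply: violates_transferrable.
by rewrite in_fset inE => /andP[_ /asboolP/(_ _ Ttr)].
Qed.

End CellTransfer.

Theorem mainTheorem10 (d : Order.disp_t) (P : porderType d)
    (O : Tlabelling P) (Q R : {fset P}) (omega sigma : P -> posint)
    (convQ : convex Q) (convR : convex R)
    (tabQ : is_tableau O Q omega) (tabR : is_tableau O R sigma) :
  (exists n : nat, halted O Q R (run O Q R omega sigma n)) /\
  (forall n : nat, halted O Q R (run O Q R omega sigma n) ->
    let st := run O Q R omega sigma n in
    let S := Sdiamond O Q R omega sigma in
    [/\ is_tableau O (wedge Q R) (obar st),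
        is_tableau O (vee Q R) (sbar st),
        {in wedge Q R, obar st =1 wedge_map Q R omega sigma S}
      & {in vee Q R, sbar st =1 vee_map Q R omega sigma S}]).
Proof.
split; first exact: run_halts.
move=> n halt /=; have cs := consistent_run tabQ tabR n.
have [_ eo es] := cs; rewrite -(halted_Sdiamond tabQ tabR convQ convR halt).
split; [exact: halted_wedge_tableau cs _ | exact: halted_vee_tableau cs _ | |].
- by move=> x xW; rewrite eo (obar_of_wedge_map _ _ _ xW).
- by move=> x xV; rewrite es (sbar_of_vee_map _ _ _ xV).
Qed.
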